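(* If $G$ is a stepwise transmission irregular (STI) graph of order $n$, then $$2\le \mathrm{diam}(G) \le \frac{n-1}{2}.$$ Moreover, the left equality holds if and only if $G \cong K_{\frac{n-1}{2},\frac{n+1}{2}}$, and the right equality holds for $G_n$.
   Context: All graphs are simple and connected. The order of a graph is its number of vertices. The distance $d_G(u,v)$ is the number of edges on a shortest $u,v$-path; the eccentricity of a vertex is its maximum distance to other vertices of $G$, and $\mathrm{diam}(G)$ is the largest eccentricity among the vertices of $G$. The transmission $\mathrm{Tr}_G(v)$ of a vertex $v$ is the sum of the distances between $v$ and all other vertices of $G$. A graph $G$ is stepwise transmission irregular (STI) if $|\mathrm{Tr}_G(u)-\mathrm{Tr}_G(v)|=1$ for every edge $uv\in E(G)$. $K_{p,q}$ denotes the complete bipartite graph with parts of sizes $p$ and $q$. For $n\ge 5$, the graph $G_n$ (hatted cycle) has vertex set $\{v_1,\ldots,v_n\}$, where $v_1,\ldots,v_{n-1}$ (in this cyclic order) induce a cycle of length $n-1$, and $v_n$ is adjacent exactly to $v_1$ and $v_3$; for every odd $n\ge 5$ it is known to be an STI graph.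
   Formalization: The one-vertex graph (vacuously STI, diameter 0) is excluded by n > 1, and the upper bound is stated for n ≠ 3, since the path P_3 = K_{1,2} is STI with diameter 2 > (3−1)/2; the equality for G_n is stated for odd n ≥ 5. *)

(* Defs.v *)
From HB Require Import structures.
From mathcomp Require Import all_boot all_order all_algebra.
Set Implicit Arguments.
Unset Strict Implicit.
Unset Printing Implicit Defensive.

Record sgraph := SGraph {
  vertex :> finType;
  edge : rel vertex;
  edge_sym : symmetric edge;
  edge_irrefl : irreflexive edge }.

Definition connected (G : sgraph) : Prop :=
  forall u v : G, connect (@edge G) u v.

Definition isomorphic (G H : sgraph) : Prop :=
  exists2 f : G -> H, bijective f & forall u v, edge (f u) (f v) = edge u v.

(* As for [path], the starting vertex u is not listed in p, so that size p is
   the number of edges. *)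
Definition is_path (G : sgraph) (u v : G) (p : seq G) : bool :=
  [&& path (@edge G) u p, last u p == v & uniq (u :: p)].

(* A path has fewer than #|G| edges, so only the lengths below #|G| are
   searched. The value is #|G| when no path joins u to v. *)
Definition dist (G : sgraph) (u v : G) : nat :=
  find (fun d => [exists p : d.-tuple G, is_path u v p]) (iota 0 #|G|).

Definition ecc (G : sgraph) (v : G) : nat := \max_(u : G | u != v) dist v u.

Definition diam (G : sgraph) : nat := \max_(v : G) ecc v.

Definition transmission (G : sgraph) (v : G) : nat :=
  \sum_(u : G | u != v) dist v u.

Definition STI (G : sgraph) : Prop :=
  forall u v : G, edge u v ->
    (`|(transmission u)%:Z - (transmission v)%:Z| = 1 :> int)%R.

Definition bip_edge (p q : nat) : rel ('I_p + 'I_q) := fun x y =>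
  match x, y with
  | inl _, inr _ | inr _, inl _ => true
  | _, _ => false
  end.

Lemma bip_edge_sym p q : symmetric (@bip_edge p q).
Proof. by case=> ? [] ?. Qed.

Lemma bip_edge_irrefl p q : irreflexive (@bip_edge p q).
Proof. by case. Qed.

Definition complete_bipartite (p q : nat) : sgraph :=
  SGraph (@bip_edge_sym p q) (@bip_edge_irrefl p q).

(* The vertex v_k is represented by k - 1 : 'I_n. *)
Definition hatted_arc (n : nat) (i j : 'I_n) : bool :=
  [&& i < n.-1, j < n.-1 & val j == i.+1 %% n.-1]
  || (val i == n.-1) && ((val j == 0) || (val j == 2)).

(* The condition i != j only matters for n <= 3, where the arcs have loops. *)
Definition hatted_edge (n : nat) : rel 'I_n := fun i j =>
  (i != j) && (hatted_arc i j || hatted_arc j i).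

Lemma hatted_edge_sym n : symmetric (@hatted_edge n).
Proof. by move=> i j; rewrite /hatted_edge eq_sym orbC. Qed.

Lemma hatted_edge_irrefl n : irreflexive (@hatted_edge n).
Proof. by move=> i; rewrite /hatted_edge eqxx. Qed.

Definition hatted_cycle (n : nat) : sgraph :=
  SGraph (@hatted_edge_sym n) (@hatted_edge_irrefl n).

(* Main.v *)
(** For an edge [uv] let [closer u v] be the set of vertices nearer to [u] than
to [v]. Parity of the transmission 2-colours an STI graph, so no vertex is
equidistant from [u] and [v]; hence [#|closer u v| + #|closer v u| = n], while
the difference of the transmissions makes these two numbers differ by 1. In
particular [n] is odd. If the diameter is 2, vertices of different colours are
adjacent, and the balance condition fixes the sizes of the two colour classes.
For [n <> 3] the balance condition excludes cut vertices, so every sphere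
around [v] of radius strictly between 0 and the eccentricity has at least two
elements; counting gives [2 diam <= n], and [n] is odd. In the hatted cycle the
hat is a twin of [v_2], so for [n >= 5] its diameter is that of the cycle on [n - 1] vertices. *)

Require Import Defs.
From HB Require Import structures.
From mathcomp Require Import all_boot all_order all_algebra.
From mathcomp Require Import zify lra.
Set Implicit Arguments.
Unset Strict Implicit.
Unset Printing Implicit Defensive.

(** * Distances and geodesics *)

Section Distance.
Variable G : sgraph.
Implicit Types u v w : G.

(** Shortening the walk removes repeated vertices, so its length falls below [#|G|], where the
    search in [dist] finds it. *)
Lemma dist_le_walk u v (p : seq G) :
  path (@edge G) u p -> last u p = v -> dist u v <= size p.
Proof.
move=> up pv; case: (shortenP up) pv => q uq Uq sqp qv.
have szq : size q < #|G| by rewrite -[_.+1]/(size (u :: q)) -(card_uniqP Uq) max_card.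
have le_qp : size q <= size p.
  by apply: uniq_leq_size; [case/andP: Uq | exact: sqp].
apply: leq_trans le_qp; rewrite leqNgt; apply/negP => lt_q.
have := before_find 0 lt_q.
rewrite nth_iota // add0n => /negbT/existsP[].
by exists (in_tuple q); rewrite /is_path /= uq qv eqxx.
Qed.

Lemma dist_walk u v : dist u v < #|G| ->
  exists p, [/\ path (@edge G) u p, last u p = v & size p = dist u v].
Proof.
move=> lt_d; set a := fun d => [exists p : d.-tuple G, is_path u v p].
have : has a (iota 0 #|G|) by rewrite has_find size_iota.
move/(nth_find 0); rewrite nth_iota // add0n => /existsP[p /and3P[up /eqP pv _]].
by exists p; rewrite size_tuple.
Qed.

Lemma distxx u : dist u u = 0.
Proof. by apply/eqP; rewrite -leqn0 (@dist_le_walk u u [::]). Qed.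

Lemma dist_edge u v : edge u v -> dist u v <= 1.
Proof. by move=> uv; rewrite (@dist_le_walk u v [:: v]) //= uv. Qed.

Lemma diam_leq m : (forall u v, dist u v <= m) -> diam G <= m.
Proof. by move=> le_m; apply/bigmax_leqP => u _; apply/bigmax_leqP => v _. Qed.

Lemma leq_diam u v : dist u v <= diam G.
Proof.
have [->|neq] := eqVneq v u; first by rewrite distxx.
by apply: (bigmax_sup u) => //; apply: (bigmax_sup v).
Qed.

Lemma transmissionE u : transmission u = \sum_v dist u v.
Proof. by rewrite [RHS](bigD1 u) //= distxx. Qed.

Hypothesis cG : connected G.

Lemma geodesic u v :
  exists p, [/\ path (@edge G) u p, last u p = v & size p = dist u v].
Proof.
apply: dist_walk; have /connectP[p up ->] := cG u v.
case: (shortenP up) => q uq Uq _.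
apply: leq_ltn_trans (dist_le_walk uq erefl) _.
by rewrite -[_.+1]/(size (u :: q)) -(card_uniqP Uq) max_card.
Qed.

Lemma dist_triangle v u w : dist u w <= dist u v + dist v w.
Proof.
have [p [up pv <-]] := geodesic u v; have [q [vq qw <-]] := geodesic v w.
rewrite -size_cat; apply: dist_le_walk; first by rewrite cat_path up pv.
by rewrite last_cat pv.
Qed.

Lemma dist_sym u v : dist u v = dist v u.
Proof.
suff le (x y : G) : dist x y <= dist y x by apply/eqP; rewrite eqn_leq !le.
have [p [yp px <-]] := geodesic y x.
rewrite -(size_belast y p) -size_rev; apply: dist_le_walk.
  rewrite -px rev_path; under eq_path => a b do rewrite edge_sym; exact: yp.
by case: p px {yp} => [|z p] //= _; rewrite rev_cons last_rcons.
Qed.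

Lemma dist_eq0 u v : (dist u v == 0) = (u == v).
Proof.
apply/eqP/eqP => [d0|->]; last exact: distxx.
by have [p [_ pv]] := geodesic u v; rewrite d0; case: p pv.
Qed.

Lemma dist_eq1 u v : (dist u v == 1) = edge u v.
Proof.
apply/eqP/idP => [d1|uv].
  have [p [up pv]] := geodesic u v; rewrite d1.
  by case: p up pv => [|x []] //= /andP[ux _] <-.
apply/eqP; rewrite eqn_leq dist_edge // lt0n dist_eq0.
by apply: contraTneq uv => ->; rewrite edge_irrefl.
Qed.

Lemma dist_pred u v : u != v -> exists2 x, edge x v & (dist u x).+1 = dist u v.
Proof.
move=> neq; have [p [up pv sz]] := geodesic u v.
case: (lastP p) up pv sz => [|q y] => [_ /= uv|]; first by rewrite uv eqxx in neq.
rewrite rcons_path last_rcons size_rcons => /andP[uq xy] <- sz.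
exists (last u q) => //.
have := dist_le_walk uq erefl; have := dist_triangle (last u q) u y.
by have := dist_edge xy; lia.
Qed.

Lemma dist_attained v b k : k <= dist v b -> exists w, dist v w = k.
Proof.
move def_d: (dist v b) => d; elim: d b def_d => [|d IHd] b db.
  by rewrite leqn0 => /eqP->; exists b.
rewrite leq_eqVlt => /orP[/eqP->|]; first by exists b.
have neq : v != b by rewrite -dist_eq0 db.
by have [x _] := dist_pred neq; rewrite db ltnS => -[/IHd].
Qed.

Lemma dist_edge_near z u v : edge u v -> dist z v <= (dist z u).+1.
Proof.
move/dist_edge; have := dist_triangle u z v; lia.
Qed.

(* Along a walk the distance to [v] changes by at most 1 per step, so a walk
   across the sphere of radius [dist v w] meets it. *)
Lemma dist_through v w a b :
  (forall z, dist v z = dist v w -> z = w) ->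
  dist v a <= dist v w -> dist v w <= dist v b ->
  dist a w + dist w b <= dist a b.
Proof.
move=> w_unique; have [p [ap pb <-]] := geodesic a b.
elim: p a ap pb => [|x p IHp] a /=.
  move=> _ ->; move=> le1 le2.
  by rewrite (w_unique b) ?distxx //; apply/eqP; rewrite eqn_leq le1.
case/andP=> ax xp pb; rewrite leq_eqVlt => /orP[/eqP/w_unique <- _|lt_a le_b].
  by rewrite distxx -[_.+1]/(size (x :: p)) dist_le_walk //= ax.
have le_x : dist v x <= dist v w by apply: leq_trans lt_a; exact: dist_edge_near.
have := IHp x xp pb le_x le_b; have := dist_triangle x a w.
have := dist_edge ax; lia.
Qed.

End Distance.

(** * Balance of edges in STI graphs *)

Definition closer (G : sgraph) (u v : G) : {set G} :=
  [set z | dist z u < dist z v].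

Section Balance.
Variable G : sgraph.
Hypotheses (cG : connected G) (sG : STI G).
Implicit Types u v w : G.

(** Each edge of a geodesic flips the parity of the transmission. *)
Lemma STI_odd_dist u v :
  odd (dist u v) = odd (transmission u) (+) odd (transmission v).
Proof.
have [p [up <- <-]] := geodesic cG u v.
elim: p u up => [|x p IHp] u /=; first by rewrite addbb.
case/andP=> ux /IHp->; have := sG ux.
move: (transmission u) (transmission x) => a b ab; lia.
Qed.

Lemma STI_dist_neq z u v : edge u v -> dist z u != dist z v.
Proof.
move=> uv; apply: contraTneq isT => eq_d.
have := STI_odd_dist z u; rewrite eq_d STI_odd_dist => /addbI.
have := STI_odd_dist u v; have /eqP-> : dist u v == 1 by rewrite dist_eq1.
by move=> + eq_o; rewrite eq_o addbb.
Qed.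

(** The two distances differ by exactly 1; the membership bits tell in which direction, without
    subtraction in [nat]. *)
Lemma STI_dist_step z u v : edge u v ->
  dist z v + (z \in closer v u) = dist z u + (z \in closer u v).
Proof.
move=> uv; rewrite !inE; have := STI_dist_neq z uv.
have := dist_edge_near cG z uv; rewrite edge_sym in uv.
have := dist_edge_near cG z uv; lia.
Qed.

Lemma card_closer u v : edge u v -> #|closer u v| + #|closer v u| = #|G|.
Proof.
move=> uv; rewrite -(cardsC (closer u v)); congr (_ + _); apply: eq_card => z.
by rewrite !inE -leqNgt ltn_neqAle eq_sym STI_dist_neq.
Qed.

Lemma closer_diff u v : edge u v ->
  transmission v + #|closer v u| = transmission u + #|closer u v|.
Proof.
move=> uv; rewrite !transmissionE -!sum1_card !(big_mkcond (mem (closer _ _))) /=.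
rewrite -!big_split /=; apply: eq_bigr => z _.
have := STI_dist_step z uv; rewrite !(dist_sym cG z).
by do 2!case: (_ \in _).
Qed.

(** The two sides of an edge add up to [#|G|] and differ by 1, so the larger has [(#|G| + 1) / 2]
    vertices. *)
Lemma card_closer_le u v : edge u v -> 2 * #|closer u v| <= #|G|.+1.
Proof.
move=> uv; have := sG uv; have := closer_diff uv; have := card_closer uv.
move: (transmission u) (transmission v) => a b; lia.
Qed.

Lemma has_edge : 1 < #|G| -> exists x y : G, edge x y.
Proof.
case/card_gt1P=> u [v [_ _ neq]].
by have [x xv _] := dist_pred cG neq; exists x, v.
Qed.

Lemma STI_odd_order : 1 < #|G| -> odd #|G|.
Proof.
case/has_edge=> x [y xy]; have := sG xy; have := closer_diff xy.
have := card_closer xy; move: (transmission x) (transmission y) => a b; lia.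
Qed.

Lemma diam_ge2 : 1 < #|G| -> 2 <= diam G.
Proof.
move=> n_gt1; rewrite ltnNge; apply/negP => diam_le1.
have [x [y xy]] := has_edge n_gt1.
(* If all distances are at most 1, each [z] is at distance 0 from one end of [xy], so the order
   would be 2, which is even. *)
have : #|G| <= #|[set x; y]|.
  apply/subset_leq_card/subsetP => z _; rewrite !inE -!(dist_eq0 cG).
  have := STI_dist_neq z xy; have := leq_diam z x; have := leq_diam z y; lia.
rewrite cards2; have := STI_odd_order n_gt1; case: (_ != _); lia.
Qed.

(* A singleton sphere [{w}] makes [w] a cut vertex. Balancing the edges from
   [w] to both sides forces both sides [A] and [B] to have equal size and the
   edge [wx] to be a bridge; the next edge [xz] inside [A] is then unbalanced. *)
Lemma sphere_not_singleton v w b :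
  #|G| <> 3 -> v != w -> dist v w < dist v b ->
  exists2 w', w' != w & dist v w' = dist v w.
Proof.
move=> n_neq3 neq_vw lt_wb.
case: (pickP [pred z | (z != w) && (dist v z == dist v w)]) => [z|nz].
  by case/andP=> ? /eqP ?; exists z.
have w_unique z : dist v z = dist v w -> z = w.
  by move=> eq_z; have := nz z; rewrite /= eq_z eqxx andbT => /negbFE/eqP.
have thru := dist_through cG w_unique.
pose A := [set z | dist v z < dist v w]; pose B := [set z | dist v w < dist v z].
have cardAB : #|A| + #|B| + 1 = #|G|.
  rewrite -(cardsC A) -addnA; congr (_ + _).
  have <- : w |: B = ~: A.
    apply/setP=> z; rewrite !inE; have [->|neq] := eqVneq z w; first by rewrite ltnn.
    by have := contra_neq (@w_unique z) neq; lia.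
  by rewrite cardsU1 inE ltnn addnC.
have [x xw dx] := dist_pred cG neq_vw.
have neq_bw : b != w by apply: contraTneq lt_wb => ->; rewrite ltnn.
(* [y] precedes [w] on a geodesic from [b]. It lies in [B], since otherwise a geodesic between [y]
   and [b] would pass through [w]. *)
have [y yw dy] := dist_pred cG neq_bw.
have yB : y \in B.
  rewrite inE ltnNge; apply/negP => le_y.
  by have := thru _ _ le_y (ltnW lt_wb); rewrite (dist_sym cG y b) (dist_sym cG w b); lia.
have xA : x \in A by rewrite inE -dx.
have d_xw : dist x w = 1 by apply/eqP; rewrite dist_eq1.
have d_yw : dist y w = 1 by apply/eqP; rewrite dist_eq1.
have Bsub : w |: B \subset closer w x.
  apply/subsetP=> t /setU1P[->|]; rewrite !inE; first by rewrite distxx (dist_sym cG) d_xw.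
  move: xA; rewrite inE => /ltnW lt_x /ltnW lt_t; have := thru _ _ lt_x lt_t.
  by rewrite !(dist_sym cG t); lia.
have Asub : w |: A \subset closer w y.
  apply/subsetP=> t /setU1P[->|]; rewrite !inE; first by rewrite distxx (dist_sym cG) d_yw.
  move: yB; rewrite inE => /ltnW lt_y /ltnW lt_t; have := thru _ _ lt_t lt_y.
  by rewrite (dist_sym cG w y); lia.
have cardwA : #|w |: A| = #|A|.+1 by rewrite cardsU1 inE ltnn.
have cardwB : #|w |: B| = #|B|.+1 by rewrite cardsU1 inE ltnn.
have leA := subset_leq_card Asub; have leB := subset_leq_card Bsub.
have wx : edge w x by rewrite edge_sym.
have wy : edge w y by rewrite edge_sym.
have := card_closer_le wx; have := card_closer_le wy => le_wy le_wx.
(* [w |: A] and [w |: B] have at most [(#|G| + 1) / 2] elements each and [#|G| + 1] in total, so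
   both bounds are attained. *)
have eqB : w |: B = closer w x.
  apply/eqP; rewrite eqEcard Bsub.
  clear -cardAB cardwA cardwB leA leB le_wy le_wx; lia.
have nearA t : t \in A -> dist t x < dist t w.
  move=> tA; have : t \notin closer w x.
    move: tA; rewrite -eqB !inE => lt_t; rewrite negb_or -leqNgt ltnW // andbT.
    by apply: contraTneq lt_t => ->; rewrite ltnn.
  by rewrite inE -leqNgt leq_eqVlt (negPf (STI_dist_neq t xw)).
(* [#|A|] equals [(#|G| - 1) / 2]; it is positive and, as [#|G|] is not 3, exceeds 1. *)
have [a aA neq_ax] : exists2 a, a \in A & a != x.
  have : 1 < #|A|.
    have : 0 < #|A| by apply/card_gt0P; exists x.
    clear -n_neq3 cardAB cardwA cardwB leA leB le_wy le_wx; lia.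
  rewrite (cardsD1 x) xA => /card_gt0P[a /setD1P[? ?]]; by exists a.
have [z zx dz] := dist_pred cG neq_ax.
(* A geodesic from [a] to a [z] outside [A] would pass through [w], which is farther from [a] than
   [x] is. *)
have zA : z \in A.
  rewrite inE ltnNge; apply/negP => le_z.
  have lt_ax := nearA a aA; move: aA; rewrite inE => /ltnW lt_a.
  by have le_az := thru _ _ lt_a le_z; clear -dz lt_ax le_az; lia.
have xz : edge x z by rewrite edge_sym.
have d_zx : dist z x = 1 by apply/eqP; rewrite dist_eq1.
(* This set has [#|B| + 2 = (#|G| + 3) / 2] elements, one more than [card_closer_le] allows. *)
have sub : x |: (w |: B) \subset closer x z.
  apply/subsetP=> t /setU1P[->|tB].
    by rewrite inE distxx (dist_sym cG) d_zx.
  have le_t : dist v w <= dist v t.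
    by case/setU1P: tB => [->|] //; rewrite inE => /ltnW.
  have lt_zx := nearA z zA; move: zA; rewrite inE => /ltnW lt_z.
  have le_zt := thru _ _ lt_z le_t; have le_xt := dist_triangle cG w x t.
  rewrite inE !(dist_sym cG t); clear -lt_zx le_zt le_xt d_zx d_xw; lia.
have := subset_leq_card sub; rewrite cardsU1 cardwB.
have -> : x \notin w |: B.
  move: xA; rewrite !inE => lt_x; rewrite negb_or -leqNgt ltnW // andbT.
  by apply: contraTneq lt_x => ->; rewrite ltnn.
have := card_closer_le xz; clear -cardAB leA le_wy cardwA; lia.
Qed.

(** The centre counts 1 and each sphere of radius 1 to [k] at least 2. *)
Lemma card_ball v b k : #|G| <> 3 -> k < dist v b ->
  2 * k < #|[set z | dist v z <= k]|.
Proof.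
move=> n_neq3; elim: k => [_|k IHk lt_k].
  by apply/card_gt0P; exists v; rewrite inE distxx.
have [w dw] := dist_attained cG (ltnW lt_k).
have neq_vw : v != w by rewrite -(dist_eq0 cG) dw.
have lt_w : dist v w < dist v b by rewrite dw.
have [w' neq_w dw'] := sphere_not_singleton n_neq3 neq_vw lt_w.
have sub : [set z | dist v z <= k] :|: [set w; w'] \subset [set z | dist v z <= k.+1].
  apply/subsetP=> z; rewrite !inE => /or3P[/leqW//|/eqP->|/eqP->]; by rewrite ?dw' dw.
have := subset_leq_card sub; rewrite cardsU.
have /eqP -> : #|[set z | dist v z <= k] :&: [set w; w']| == 0.
  rewrite cards_eq0; apply/eqP/setP=> z; rewrite !inE.
  by apply/negP=> /andP[+ /orP[]/eqP e]; rewrite e ?dw' dw ltnn.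
rewrite cards2 eq_sym neq_w; have := IHk (ltnW lt_k); lia.
Qed.

Lemma double_diam_lt : 1 < #|G| -> #|G| <> 3 -> 2 * diam G < #|G|.
Proof.
move=> n_gt1 n_neq3; have odd_n := STI_odd_order n_gt1.
suff : diam G <= (#|G|.-1)./2 by lia.
apply: diam_leq => v b; case: (posnP (dist v b)) => [->//|d_gt0].
have lt_d : (dist v b).-1 < dist v b by lia.
have := card_ball n_neq3 lt_d.
(* [b] lies outside the ball of radius [dist v b - 1], whence [2 * dist v b <= #|G|]; oddness of
   [#|G|] makes this strict. *)
have : #|b |: [set z | dist v z <= (dist v b).-1]| <= #|G| by exact: max_card.
rewrite cardsU1 inE -ltnNge lt_d; lia.
Qed.

(** Among the distances 0, 1 and 2 only 1 is odd. *)
Lemma diam2_bipartite : diam G = 2 ->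
  forall u v, edge u v = (odd (transmission u) != odd (transmission v)).
Proof.
move=> d2 u v; rewrite -(dist_eq1 cG).
have := STI_odd_dist u v; have := leq_diam u v; rewrite d2.
move: (odd (transmission u)) (odd (transmission v)) => a b.
by case: (dist u v) => [|[|[|]]] //= _; case: a; case: b.
Qed.

(** For an edge [xy] with [y] of colour [b], [closer x y] is the class of [b] with [y] replaced by
    [x], so the balance bound applies to the class. *)
Lemma card_side (c : pred G) b : 1 < #|G| ->
  (forall u v, edge u v = (c u != c v)) -> 2 * #|[pred u | c u == b]| <= #|G|.+1.
Proof.
move=> n_gt1 edgeE.
have [x [y [xy cy]]] : exists x y, edge x y /\ c y = b.
  have [x [y xy]] := has_edge n_gt1; have := xy; rewrite edgeE.
  case: (eqVneq (c y) b) => [cy _|cyb cxy]; first by exists x, y.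
  exists y, x; rewrite edge_sym xy; split=> //.
  by move: cyb cxy; case: (c x); case: (c y); case: b.
apply: leq_trans (card_closer_le xy); rewrite leq_mul2l /=.
have -> : closer x y = x |: [set z | c z == b] :\ y.
  apply/setP=> z; rewrite !inE; have := STI_dist_neq z xy.
  have := xy; rewrite edgeE cy => cxb.
  have [->|neq_zx] := eqVneq z x; first by rewrite distxx lt0n eq_sym.
  have [->|neq_zy] := eqVneq z y; first by rewrite distxx.
  have [czb|czb] := eqVneq (c z) b.
    have /eqP-> : dist z x == 1 by rewrite (dist_eq1 cG) edgeE czb eq_sym.
    have : dist z y != 0 by rewrite (dist_eq0 cG).
    by case: (dist z y) => [|[]].
  have /eqP-> : dist z y == 1 by rewrite (dist_eq1 cG) edgeE cy.
  by rewrite ltnS leqn0 (dist_eq0 cG) (negPf neq_zx).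
have xNb : x \notin [set z | c z == b] :\ y.
  by move: xy; rewrite edgeE cy !inE negb_and => ->; rewrite orbT.
rewrite cardsU1 xNb -(cardsE [pred u | c u == b]) (cardsD1 y) !inE cy eqxx.
by rewrite leq_add2l; apply/subset_leq_card/subsetP=> z; rewrite !inE.
Qed.

End Balance.

(** * Complete bipartite graphs *)

Lemma bipartite_iso (G : sgraph) (c : pred G) :
  (forall u v, edge u v = (c u != c v)) ->
  isomorphic G (complete_bipartite #|[pred u | c u]| #|[pred u | ~~ c u]|).
Proof.
move=> edgeE; set P := [pred u | c u]; set Q := [pred u | ~~ c u].
pose g (s : complete_bipartite #|P| #|Q|) : G :=
  match s with inl i => enum_val i | inr j => enum_val j end.
have cg s : c (g s) = if s is inl _ then true else false.
  by case: s => [i|j] /=; [exact: (enum_valP i) | exact/negbTE/(enum_valP j)].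
(* The colour of [g s] determines the summand of [s]. *)
have g_inj : injective g.
  move=> s t eq_g; have := cg s; rewrite eq_g cg.
  by case: s t eq_g => [i|i] [j|j] //= /enum_val_inj->.
have [|f gK fK] := inj_card_bij g_inj.
  by rewrite /= card_sum !card_ord -(cardC P).
exists f; first by exists g.
by move=> u v; rewrite edgeE -{2}(fK u) -{2}(fK v) !cg; case: (f u) (f v) => [?|?] [?|?].
Qed.

Lemma diam_complete_bipartite (G : sgraph) p q : 0 < p -> 0 < q ->
  isomorphic G (complete_bipartite p q) -> diam G <= 2.
Proof.
move=> p_gt0 q_gt0 [f [h _ hK] fE]; apply: diam_leq => u v.
have via z : edge u z -> edge z v -> dist u v <= 2.
  by move=> uz zv; rewrite (@dist_le_walk _ u v [:: z; v]) //= uz zv.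
case fu: (f u) => [i|i]; case fv: (f v) => [j|j].
- by apply: (via (h (inr (Ordinal q_gt0)))); rewrite -fE hK ?fu ?fv.
- by apply/leqW/dist_edge; rewrite -fE fu fv.
- by apply/leqW/dist_edge; rewrite -fE fu fv.
- by apply: (via (h (inl (Ordinal p_gt0)))); rewrite -fE hK ?fu ?fv.
Qed.

Lemma diam2_iso (G : sgraph) : connected G -> STI G -> 1 < #|G| -> diam G = 2 ->
  isomorphic G (complete_bipartite ((#|G| - 1) %/ 2) ((#|G| + 1) %/ 2)).
Proof.
move=> cG sG n_gt1 d2; have odd_n := STI_odd_order cG sG n_gt1.
set c := fun u : G => odd (transmission u).
have edgeE : forall u v, edge u v = (c u != c v) := diam2_bipartite cG sG d2.
have sideT := card_side cG sG true n_gt1 edgeE.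
have sideF := card_side cG sG false n_gt1 edgeE.
have cardT : #|[pred u | c u == true]| = #|[pred u | c u]|.
  by apply: eq_card => u; rewrite !inE eqb_id.
have cardF : #|[pred u | c u == false]| = #|[pred u | ~~ c u]|.
  by apply: eq_card => u; rewrite !inE eqbF_neg.
have cardTF : #|[pred u | c u]| + #|[pred u | ~~ c u]| = #|G|.
  by rewrite -(cardC [pred u | c u]).
rewrite cardT in sideT; rewrite cardF in sideF.
have isoT := bipartite_iso edgeE.
(* Either colour class may be the smaller one, so both orders of the parts are needed. *)
have isoF : isomorphic G (complete_bipartite #|[pred u | ~~ c u]| #|[pred u | c u]|).
  have NE u v : edge u v = (~~ c u != ~~ c v) by rewrite edgeE; do 2!case: (c _).
  have := bipartite_iso NE; congr (isomorphic G (complete_bipartite _ _)).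
  by apply: eq_card => u; rewrite !inE negbK.
clear -odd_n sideT sideF cardTF isoT isoF.
move: #|[pred u | c u]| #|[pred u | ~~ c u]| sideT sideF cardTF isoT isoF => P Q.
move=> sideT sideF cardTF isoT isoF; case: (ltnP P Q) => PQ.
  have -> : (#|G| - 1) %/ 2 = P by lia.
  by have -> : (#|G| + 1) %/ 2 = Q by lia.
have -> : (#|G| - 1) %/ 2 = Q by lia.
by have -> : (#|G| + 1) %/ 2 = P by lia.
Qed.

(** A potential that rises by at most 1 per edge bounds distances from below; [dist u v < #|G|]
    guarantees a walk. *)
Lemma dist_lipschitz (G : sgraph) (h : G -> nat) (u v : G) :
  (forall x y, edge x y -> h y <= (h x).+1) ->
  dist u v < #|G| -> h v <= h u + dist u v.
Proof.
move=> lip /dist_walk[p [up <- <-]] {v}.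
elim: p u up => [|x p IHp] u /=; first by rewrite addn0.
by case/andP=> /lip ux /IHp; lia.
Qed.

(** * The diameter of hatted cycles *)

Section HattedCycle.
Variable m : nat.
Hypothesis m_gt1 : 1 < m.
Let H := hatted_cycle (2 * m).+1.
Let vtx (i : nat) : H := inord i : 'I_(2 * m).+1.

Let vtx_val (u : H) : vtx (val u) = u.
Proof. exact: inord_val. Qed.

Let le_val (u : H) : val u <= 2 * m.
Proof. by rewrite -ltnS; exact: ltn_ord. Qed.

(** Removing the modulus leaves linear conditions that [lia] decides; index [2 * m] is the hat. *)
Lemma vtx_edge i j : i <= 2 * m -> j <= 2 * m ->
  edge (vtx i) (vtx j) =
    [|| (j == i.+1) && (j < 2 * m), (i == j.+1) && (i < 2 * m),
        (i == 0) && (j == (2 * m).-1), (j == 0) && (i == (2 * m).-1),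
        (i == 2 * m) && ((j == 0) || (j == 2)) |
        (j == 2 * m) && ((i == 0) || (i == 2))].
Proof.
move=> le_i le_j; rewrite /edge /= /hatted_edge /hatted_arc -val_eqE /= !inordK ?ltnS //.
have modE k : k < 2 * m -> k.+1 %% (2 * m) = if k.+1 == 2 * m then 0 else k.+1.
  by move=> lt_k; case: eqP => [->|/eqP ne]; [rewrite modnn | rewrite modn_small //; lia].
case: (ltnP i (2 * m)) => hi; case: (ltnP j (2 * m)) => hj /=;
  rewrite ?modE //; do ?[case: ifP => ?]; clear modE; lia.
Qed.

Lemma hatted_connected : connected H.
Proof.
have csym : connect_sym (@edge H) by apply: sym_connect_sym; exact: edge_sym.
suff c0 i : i <= 2 * m -> connect (@edge H) (vtx 0) (vtx i).
  move=> u v; apply: (@connect_trans _ _ (vtx 0)).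
    by rewrite csym -(vtx_val u) c0.
  by rewrite -(vtx_val v) c0.
rewrite leq_eqVlt => /orP[/eqP->|]; first by apply: connect1; rewrite vtx_edge //; lia.
elim: i => [|i IHi] lt_i; first exact: connect0.
by apply: (connect_trans (IHi (ltnW lt_i))); apply: connect1; rewrite vtx_edge //; lia.
Qed.

Let cH := hatted_connected.

Lemma dist_cycle i k : i + k < 2 * m -> dist (vtx i) (vtx (i + k)) <= k.
Proof.
elim: k => [|k IHk] lt_k; first by rewrite addn0 distxx.
have e : edge (vtx (i + k)) (vtx (i + k.+1)) by rewrite vtx_edge; lia.
have := dist_triangle cH (vtx (i + k)) (vtx i) (vtx (i + k.+1)).
have := IHk (ltac:(lia)); have := dist_edge e; lia.
Qed.

Lemma dist_arc i j : i <= j -> j < 2 * m -> dist (vtx i) (vtx j) <= j - i.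
Proof. by move=> le_ij lt_j; rewrite -{1}(subnKC le_ij) dist_cycle ?subnKC. Qed.

(** The two arcs between cycle vertices have total length [2 * m], so one has length at most [m]. *)
Lemma hatted_dist_le i j : i <= j -> j <= 2 * m -> dist (vtx i) (vtx j) <= m.
Proof.
have arc0 k : 0 < k -> k < 2 * m -> dist (vtx k) (vtx 0) <= 2 * m - k.
  move=> k_gt0 lt_k; have e : edge (vtx (2 * m).-1) (vtx 0) by rewrite vtx_edge; lia.
  have := dist_triangle cH (vtx (2 * m).-1) (vtx k) (vtx 0).
  have := @dist_arc k (2 * m).-1 (ltac:(lia)) (ltac:(lia)); have := dist_edge e; lia.
have e0 : edge (vtx 0) (vtx (2 * m)) by rewrite vtx_edge; lia.
have e2 : edge (vtx 2) (vtx (2 * m)) by rewrite vtx_edge; lia.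
have d0 := dist_edge e0; have d2 := dist_edge e2.
move=> le_ij; rewrite leq_eqVlt => /orP[/eqP ej|lt_j]; last first.
  have [->|i_gt0] := posnP i.
    have [->|j_gt0] := posnP j; first by rewrite distxx.
    have := @dist_arc 0 j isT lt_j; have := arc0 j j_gt0 lt_j.
    by rewrite (dist_sym cH (vtx j)); lia.
  have := arc0 j (leq_trans i_gt0 le_ij) lt_j.
  have := @dist_arc 0 i isT (leq_ltn_trans le_ij lt_j).
  have := dist_triangle cH (vtx 0) (vtx i) (vtx j).
  have := dist_arc le_ij lt_j.
  by rewrite (dist_sym cH (vtx j)) (dist_sym cH (vtx i) (vtx 0)); lia.
(* The hat is reached through index 0 or 2. For [i > 2] the two routes have total length [2 * m];
   for [i <= 2] one has length at most 2, hence at most [m]. *)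
rewrite ej in le_ij *; case: (ltngtP i (2 * m)) le_ij => [lt_i _|//|-> _]; last by rewrite distxx.
have := dist_triangle cH (vtx 0) (vtx i) (vtx (2 * m)).
have := dist_triangle cH (vtx 2) (vtx i) (vtx (2 * m)).
have [le_i|i_gt2] := leqP i 2.
  have := @dist_arc 0 i isT lt_i; rewrite (dist_sym cH (vtx 0) (vtx i)).
  have := @dist_arc i 2 le_i (ltac:(lia)); lia.
have := arc0 i (ltac:(lia)) lt_i; have := @dist_arc 2 i (ltnW i_gt2) lt_i.
rewrite (dist_sym cH (vtx 2) (vtx i)); lia.
Qed.

Lemma diam_hatted : diam H = m.
Proof.
apply/eqP; rewrite eqn_leq; apply/andP; split.
  apply: diam_leq => u v; rewrite -(vtx_val u) -(vtx_val v).
  case: (leqP (val u) (val v)) => [le|/ltnW le]; first exact: hatted_dist_le.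
  by rewrite (dist_sym cH) hatted_dist_le.
(* [h] is the distance to [v_1]. *)
pose h (u : H) := if val u == 2 * m then 1 else minn (val u) (2 * m - val u).
have lip x y : edge x y -> h y <= (h x).+1.
  rewrite -(vtx_val x) -(vtx_val y) vtx_edge // !vtx_val /h.
  move: (le_val x) (le_val y); move: (val x) (val y) => i j; do 2![case: ifP => ?]; lia.
(* Indices 0 and [m] are antipodal on the cycle: [h] is 0 at the first and [m] at the second. *)
have le_m := @hatted_dist_le 0 m isT (ltac:(lia)).
have lt_d : dist (vtx 0) (vtx m) < #|H|.
  by apply: leq_ltn_trans le_m _; rewrite [#|H|]card_ord; lia.
have := dist_lipschitz lip lt_d; have := leq_diam (vtx 0) (vtx m).
move: (dist _ _) => d; rewrite /h /= !inordK ?ltnS //; last lia.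
by do 2![case: ifP => ?]; lia.
Qed.

End HattedCycle.

(* The one-vertex graph is vacuously STI and has diameter 0, and the path on
   three vertices K_{1,2} is STI with diameter 2 > (3 - 1) / 2: hence 1 < n,
   and n <> 3 for the upper bound. *)
Theorem lemma3p1 (n : nat) :
  (forall G : sgraph, connected G -> STI G -> #|G| = n -> 1 < n ->
     [/\ 2 <= diam G,
         n <> 3 -> ((diam G)%:R <= (n%:R - 1) / 2 :> rat)%R
       & diam G = 2 <->
         isomorphic G (complete_bipartite ((n - 1) %/ 2) ((n + 1) %/ 2))])
  /\ (odd n -> 5 <= n ->
      ((diam (hatted_cycle n))%:R = (n%:R - 1) / 2 :> rat)%R).
Proof.
split=> [G cG sG <- n_gt1 | odd_n n_ge5].
  have d_ge2 := diam_ge2 cG sG n_gt1; split=> //.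
    (* In [nat] the strict bound is [(2 * diam G).+1 <= #|G|], so the cast to [rat] loses
       nothing. *)
    move/(double_diam_lt cG sG n_gt1); rewrite -(Num.Theory.ler_nat rat) -GRing.natr1 GRing.natrM; lra.
  split=> [|iso]; first exact: diam2_iso.
  apply/eqP; rewrite eqn_leq d_ge2 andbT; have odd_n := STI_odd_order cG sG n_gt1.
  by apply: diam_complete_bipartite iso; lia.
have [m n_eq m_gt1] : exists2 m, n = (2 * m).+1 & 1 < m by exists n./2; lia.
by rewrite n_eq diam_hatted // -GRing.natr1 GRing.natrM; lra.
Qed.
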